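(* Let $X$ be a max-$\cdot$ convex compactum. Then the following statements are equivalent: (1) the map $\beta^\cdot_X|_{A^\cdot_\omega(X)}:A^\cdot_\omega(X)\to X$ is open (where $A^\cdot_\omega(X)$ carries the subspace topology from $A^\cdot(X)$); (2) the map $\beta^\cdot_X:A^\cdot(X)\to X$ is open; (3) the map $s_X:X\times X\times J\to X$, $s_X(x,y,t,p)=t\cdot x\vee p\cdot y$, is open, where $J=\{(t,p)\in[0,1]\times[0,1]\mid t\vee p=1\}$.
   Context: A subset $A\subset[0,1]^T$ is max-$\cdot$ convex if $\lambda\cdot a\vee b\in A$ for all $a,b\in A$, $\lambda\in[0,1]$ (coordinatewise maximum and scalar multiplication, $\cdot$ having priority over $\vee$); a max-$\cdot$ convex compactum is a compact max-$\cdot$ convex subset of some $[0,1]^T$ (product topology). For a compact Hausdorff space $X$, $C(X,[0,1])$ is the set of continuous functions $X\to[0,1]$, and $A^\cdot(X)$ is the set of $\cdot$-measures: functionals $\mu:C(X,[0,1])\to[0,1]$ with $\mu(1_X)=1$ ($c_X$ is the constant function with value $c$), $\mu(\lambda_X\cdot\varphi)=\lambda\cdot\mu(\varphi)$ for $\lambda\in[0,1]$, and $\mu(\psi\vee\varphi)=\mu(\psi)\vee\mu(\varphi)$ for $\psi,\varphi\in C(X,[0,1])$. It is topologized as a subspace of $[0,1]^{C(X,[0,1])}$ (product topology). $\delta_x$ is the Dirac measure, $\delta_x(\varphi)=\varphi(x)$, and $$A^\cdot_\omega(X)=\Big\{\bigvee_{i=1}^n\lambda_i\cdot\delta_{x_i}\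 \Big|\ n\in\mathbb{N},\ x_1,\dots,x_n\in X,\ \lambda_1,\dots,\lambda_n\in[0,1],\ \bigvee_{i=1}^n\lambda_i=1\Big\}\subset A^\cdot(X),$$ where $(\bigvee_i\lambda_i\cdot\delta_{x_i})(\varphi)=\max_i\lambda_i\varphi(x_i)$. Barycenter map: for a compact max-$\cdot$ convex $X\subset[0,1]^T$, $\beta^\cdot_X:A^\cdot(X)\to X$ is defined by letting the $t$-th coordinate of $\beta^\cdot_X(\mu)$ be $\mu(\mathrm{pr}_t|_X)$, where $\mathrm{pr}_t:[0,1]^T\to[0,1]$ is the $t$-th projection. (It is known that $\beta^\cdot_X$ is a well-defined continuous map into $X$.) *)

(* Defs.v *)
From HB Require Import structures.
From mathcomp Require Import all_boot all_order all_algebra.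
From mathcomp Require Import all_classical all_reals all_analysis.

Set Implicit Arguments.
Unset Strict Implicit.
Unset Printing Implicit Defensive.

Import Order.TTheory GRing.Theory Num.Theory.
Import numFieldNormedType.Exports.
Local Open Scope classical_set_scope.
Local Open Scope ring_scope.

(* [f] restricts to an open map from [A] to [B], both with the subspace
   topology: images of relatively open subsets of [A] are relatively open
   subsets of [B] (taking [U = setT], this includes [f @` A `<=` B]). *)
Definition open_map_on (S S' : topologicalType) (A : set S) (B : set S')
    (f : S -> S') : Prop :=
  forall U : set S, open U ->
    exists2 V : set S', open V & f @` (A `&` U) = B `&` V.

Definition unit_range (R : realType) (Y : Type) (f : Y -> R) : Prop :=
  forall y, 0 <= f y <= 1.

Section MaxDotConvex.
Context (R : realType) (T : Type).
Implicit Types (a b : {ptws T -> R}) (X : set {ptws T -> R}).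

Definition cube : set {ptws T -> R} := [set a | unit_range a].

Definition maxdot_convex X : Prop :=
  forall a b (l : R), X a -> X b -> 0 <= l <= 1 ->
    X (fun t => Num.max (l * a t) (b t)).

Definition J : set (R * R) :=
  [set tp | [/\ 0 <= tp.1 <= 1, 0 <= tp.2 <= 1 & Num.max tp.1 tp.2 = 1]].

Definition s_map (z : {ptws T -> R} * {ptws T -> R} * (R * R)) :
    {ptws T -> R} :=
  fun t => Num.max (z.2.1 * z.1.1 t) (z.2.2 * z.1.2 t).

End MaxDotConvex.

Arguments cube : clear implicits.
Arguments J : clear implicits.
Arguments s_map : clear implicits.

Section DotMeasures.
Context (R : realType) (X : topologicalType).

Definition C01 : Type := {f : X -> R | continuous f /\ unit_range f}.

Definition C01_fun (f : C01) : X -> R := proj1_sig f.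
Coercion C01_fun : C01 >-> Funclass.

Lemma C01_cst_subproof (c : R) :
  0 <= c <= 1 -> continuous (fun _ : X => c) /\ unit_range (fun _ : X => c).
Proof. by move=> c01; split=> // x; exact: cvg_cst. Qed.

Definition C01_cst (c : R) (c01 : 0 <= c <= 1) : C01 :=
  exist _ (fun=> c) (C01_cst_subproof c01).

Lemma C01_mul_subproof (f g : C01) :
  continuous (fun x => f x * g x) /\ unit_range (fun x => f x * g x).
Proof.
case: f g => [f [cf f01]] [g [cg g01]] /=; split=> x.
  by apply: cvgM; [exact: cf | exact: cg].
have /andP[f0 f1] := f01 x; have /andP[g0 g1] := g01 x.
by rewrite /C01_fun /= mulr_ge0 //= mulr_ile1.
Qed.

Definition C01_mul (f g : C01) : C01 :=
  exist _ (fun x => f x * g x) (C01_mul_subproof f g).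

Lemma C01_max_subproof (f g : C01) :
  continuous (fun x => Num.max (f x) (g x)) /\
  unit_range (fun x => Num.max (f x) (g x)).
Proof.
case: f g => [f [cf f01]] [g [cg g01]] /=; split=> x.
  exact: (max_fun_continuous cf cg).
have /andP[f0 f1] := f01 x; have /andP[g0 g1] := g01 x.
by rewrite /C01_fun /= le_max f0 ge_max f1 g1.
Qed.

Definition C01_max (f g : C01) : C01 :=
  exist _ (fun x => Num.max (f x) (g x)) (C01_max_subproof f g).

Lemma unit_01 : 0 <= (1 : R) <= 1.
Proof. by rewrite ler01 lexx. Qed.

Definition dot_measures : set {ptws C01 -> R} :=
  [set mu | [/\ unit_range mu,
      mu (C01_cst unit_01) = 1,
      forall (l : R) (l01 : 0 <= l <= 1) (f : C01),
        mu (C01_mul (C01_cst l01) f) = l * mu f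
    & forall f g : C01, mu (C01_max f g) = Num.max (mu f) (mu g)]].

Definition dirac_functional (x : X) : {ptws C01 -> R} := fun f => f x.

(* The weights are nonnegative, so the default value [0] of the iterated maximum
   matters only for [n = 0], which the normalization excludes. *)
Definition dot_measures_omega : set {ptws C01 -> R} :=
  [set mu | exists (n : nat) (x : 'I_n -> X) (l : 'I_n -> R),
    [/\ unit_range l, \big[Num.max/0]_(i < n) l i = 1
      & mu = fun f => \big[Num.max/0]_(i < n) (l i * dirac_functional (x i) f)]].

End DotMeasures.

Arguments dot_measures : clear implicits.
Arguments dot_measures_omega : clear implicits.

Section Barycenter.
Context (R : realType) (T : Type) (X : set {ptws T -> R}).
Context (X01 : X `<=` cube R T).

Lemma C01_pr_subproof (t : T) :
  continuous (fun x : set_type X => (set_val x : {ptws T -> R}) t) /\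
  unit_range (fun x : set_type X => (set_val x : {ptws T -> R}) t).
Proof.
split=> x; last by apply: X01; exact: set_valP.
apply: (@continuous_comp _ _ _ (set_val : set_type X -> {ptws T -> R})
  (fun a : {ptws T -> R} => a t)).
  exact: initial_continuous.
exact: (@proj_continuous {classic T} (fun=> R) t).
Qed.

Definition C01_pr (t : T) : C01 R (set_type X) :=
  exist _ (fun x => (set_val x : {ptws T -> R}) t) (C01_pr_subproof t).

Definition barycenter (mu : {ptws C01 R (set_type X) -> R}) : {ptws T -> R} :=
  fun t => mu (C01_pr t).

End Barycenter.

(* Main.v *)
(* Everything rests on one fact: each fibre of the barycenter map [beta] has a dense
   set of finitely supported measures. Given [mu], cut it with finitely many bump
   functions [psi_u] whose pointwise maximum is [1] and let
   [mu_u f = mu (psi_u f) / mu psi_u]. Then [\/_u mu(psi_u) . delta_(beta mu_u)] has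
   the same barycenter as [mu], and it is close to [mu] because [beta mu_u] stays in
   the small box carrying [psi_u]. Hence [A_omega `&` U] and [A `&` U] have the same
   image under [beta] for every open [U], which gives (1) <-> (2).
   For (2) -> (3), when [x != y] and [t, p > 0], cutting a measure near
   [t . delta_x \/ p . delta_y] with two functions separating [x] from [y] and taking
   the barycenters and masses of the two pieces inverts [s_X] continuously; in the
   other cases [s_X] has an explicit continuous section.
   For (3) -> (1), finitely supported measures are built from Dirac measures by
   successive joins [l . delta_x \/ nu], to each of which openness of [s_X]
   applies. *)
Require Import Defs.
From mathcomp Require Import all_boot all_order all_algebra.
From mathcomp Require Import all_classical all_reals all_analysis.
From mathcomp Require Import lra.

Set Implicit Arguments.
Unset Strict Implicit.
Unset Printing Implicit Defensive.
Import Order.TTheory GRing.Theory Num.Theory.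
Import numFieldNormedType.Exports.
Local Open Scope classical_set_scope.
Local Open Scope ring_scope.

(** * Pointwise topology and subtypes *)

Section Topology.
Context (R : realType).

Lemma ptws_cvgP (I : Type) (F : set_system (I -> R)) (g : I -> R) :
  Filter F ->
  (forall i, (fun h => h i) @ F --> g i) -> F --> (g : {ptws I -> R}).
Proof.
move=> FF Fg; apply/cvg_sup => i; apply/cvg_image.
  by rewrite eqEsubset; split => v // _; exists (fun=> v).
move=> W /Fg Q; exists ((fun h => h i) @^-1` W) => //.
by rewrite eqEsubset; split => [j [? + <-//]|j Wj]; exists (fun=> j).
Qed.

Lemma ptws_eval_continuous (I : Type) (i : I) :
  continuous (fun g : {ptws I -> R} => g i).
Proof. exact: (@proj_continuous {classic I} (fun=> R) i). Qed.

(** The sets that contain a box around [g] form a filter, and it converges to [g] in every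
    coordinate, hence in the product topology. Membership in a list of indices needs decidable
    equality, hence [{classic I}]. *)
Lemma ptws_nbhs_basis (I : Type) (g : {ptws I -> R}) (U : set {ptws I -> R}) :
  nbhs g U ->
  exists s : seq {classic I}, exists2 e : R, 0 < e &
    forall h : {ptws I -> R}, (forall i, i \in s -> `|h i - g i| < e) -> U h.
Proof.
pose F : set_system (I -> R) := [set W | exists s : seq {classic I},
  exists2 e : R, 0 < e &
    forall h : I -> R, (forall i, i \in s -> `|h i - g i| < e) -> W h].
have FF : Filter F.
  constructor=> [|A B [s [e e0 sA]] [s' [e' e'0 s'B]]|A B AB [s [e e0 sA]]].
  - by exists [::], 1.
  - exists (s ++ s'), (Num.min e e'); first by rewrite lt_min e0.
    move=> h hB; split; [apply: sA|apply: s'B] => i si;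
      have := hB i; rewrite mem_cat si ?orbT lt_min => /(_ isT) /andP[] //.
  - by exists s, e => // h /sA/AB.
suff : F --> g by exact.
apply: ptws_cvgP => i; apply/cvgrPdist_lt => e e0 /=.
exists [:: i : {classic I}], e => // h /(_ i); rewrite inE eqxx => /(_ isT).
by rewrite distrC.
Qed.

(** The implication from [B z] turns a relative neighborhood into an ambient one, so that openness
    can be checked at one point at a time. *)
Lemma open_map_onP (S S' : topologicalType) (A : set S) (B : set S')
    (f : S -> S') : (forall a, A a -> B (f a)) ->
  open_map_on A B f <->
  (forall a (U : set S), A a -> nbhs a U ->
     nbhs (f a) [set z | B z -> (f @` (A `&` U)) z]).
Proof.
move=> fAB; split=> [fo a U Aa|fo U oU].
  rewrite nbhsE => -[U' [oU' U'a] U'U].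
  have [V oV fV] := fo _ oU'.
  rewrite nbhsE; exists V.
    split=> //; suff : (B `&` V) (f a) by case.
    by rewrite -fV; exists a.
  move=> z Vz /= Bz; suff : (f @` (A `&` U')) z.
    by case=> b [Ab /U'U Ub] <-; exists b.
  by rewrite fV.
exists (interior [set z | B z -> (f @` (A `&` U)) z]); first exact: open_interior.
rewrite eqEsubset; split=> [_ [a [Aa Ua] <-]|z [Bz /interior_subset]]; last exact.
by split; [exact: fAB|apply: fo => //; exact: open_nbhs_nbhs].
Qed.

Lemma nbhs_set_val (S : topologicalType) (A : set S) (x : A) (U : set A) :
  nbhs x U <-> exists2 V, nbhs (set_val x) V & set_val @^-1` V `<=` U.
Proof.
split=> [|[V xV VU]]; last first.
  by apply: filterS VU _; exact: (@initial_continuous A S set_val x).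
move=> [W [[V oV <-] Vx] VU]; exists V => //; exact: open_nbhs_nbhs.
Qed.

(** Near-covering compactness is applied to the filter of lists ordered by inclusion: near [a],
    every list that contains the point [a] of the subtype will do. *)
Lemma compact_set_type_cover (S : topologicalType) (A : set S)
    (K : A -> set A) : compact A -> (forall u, nbhs u (K u)) ->
  exists s : seq A, forall v, exists2 u, u \in s & K u v.
Proof.
move=> /compact_near_coveringP Ac Kn.
pose F : set_system (seq A) :=
  [set W | exists s : seq A, forall s' : seq A, {subset s <= s'} -> W s'].
have FF : Filter F.
  constructor=> [|P Q [s sP] [s' s'Q]|P Q PQ [s sP]].
  - by exists [::].
  - exists (s ++ s') => t st; split; [apply: sP|apply: s'Q] => i si;
      by apply: st; rewrite mem_cat si ?orbT.
  - by exists s => t /sP/PQ.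
have [|s Hs] := Ac _ F (fun s a => forall v : A, set_val v = a ->
    exists2 u, u \in s & K u v).
  move=> a Aa; pose u : A := SigSub (mem_set Aa).
  have /nbhs_set_val[V aV VK] := Kn u.
  exists (V, [set s : seq A | u \in s]).
    split=> //=; exists [:: u] => s; apply; exact: mem_head.
  move=> [b s] /= [Vb us] v vb; exists u => //; apply: VK.
  by rewrite /preimage /= vb.
by exists s => v; exact: (Hs s (fun _ => id) _ (set_valP v)).
Qed.

End Topology.

(** * Algebra of dot-measures *)

Section BigMax.
Context (R : realType) (I : Type).
Implicit Types (s : seq I) (F G : I -> R).

Lemma bigmaxr_le s F (c : R) :
  0 <= c -> (forall i, F i <= c) -> \big[Num.max/0]_(i <- s) F i <= c.
Proof.
by move=> c0 Fc; elim/big_ind: _ => // x y xc yc; rewrite ge_max xc.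
Qed.

Lemma bigmaxrM s F (c : R) : 0 <= c ->
  \big[Num.max/0]_(i <- s) (c * F i) = c * \big[Num.max/0]_(i <- s) F i.
Proof.
move=> c0; rewrite (big_morph ( *%R c) (id1 := 0) (op1 := Num.max)) ?mulr0//.
by move=> x y; rewrite maxr_pMr.
Qed.

Lemma dist_max (a b c d e : R) :
  `|a - b| <= e -> `|c - d| <= e -> `|Num.max a c - Num.max b d| <= e.
Proof.
rewrite !ler_norml => /andP[? ?] /andP[? ?].
by case: (leP a c) => ?; case: (leP b d) => ?; apply/andP; split; lra.
Qed.

Lemma dist_bigmaxr s F G (e : R) :
  0 <= e -> (forall i, `|F i - G i| <= e) ->
  `|\big[Num.max/0]_(i <- s) F i - \big[Num.max/0]_(i <- s) G i| <= e.
Proof.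
move=> e0 FG; elim: s => [|i s IH]; first by rewrite !big_nil subrr normr0.
by rewrite !big_cons; apply: dist_max.
Qed.

End BigMax.

Section DotMeasureTheory.
Context (R : realType) (X : topologicalType).
Implicit Types (mu : {ptws C01 R X -> R}) (f g h psi : C01 R X).

Lemma C01_ext f g : f =1 g -> f = g.
Proof.
by move=> /funext fg; apply: eq_sig_hprop fg => h p q; exact: Prop_irrelevance.
Qed.

Lemma C01_ge0 f x : 0 <= f x.
Proof. by have /andP[] := (proj2_sig f).2 x. Qed.

Lemma C01_le1 f x : f x <= 1.
Proof. by have /andP[] := (proj2_sig f).2 x. Qed.

Lemma C01_continuous f : continuous f.
Proof. exact: (proj2_sig f).1. Qed.

Lemma C01_mulE f g x : C01_mul f g x = f x * g x.
Proof. by []. Qed.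

Section FixedMeasure.
Context (mu : {ptws C01 R X -> R}) (Amu : dot_measures R X mu).

Lemma dot_ge0 f : 0 <= mu f.
Proof. by case: Amu => mu01 _ _ _; have /andP[] := mu01 f. Qed.

Lemma dot_le1 f : mu f <= 1.
Proof. by case: Amu => mu01 _ _ _; have /andP[] := mu01 f. Qed.

Lemma dot1 f : (forall x, f x = 1) -> mu f = 1.
Proof. by move=> f1; case: Amu => _ + _ _; move=> <-; congr mu; exact: C01_ext. Qed.

Lemma dotZ (l : R) f g :
  0 <= l <= 1 -> (forall x, g x = l * f x) -> mu g = l * mu f.
Proof.
by move=> l01 gf; case: Amu => _ _ + _; move=> <-; congr mu; exact: C01_ext.
Qed.

Lemma dot_max f g h :
  (forall x, h x = Num.max (f x) (g x)) -> mu h = Num.max (mu f) (mu g).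
Proof.
by move=> hfg; case: Amu => _ _ _; move=> <-; congr mu; exact: C01_ext.
Qed.

Lemma dot_le f g : (forall x, f x <= g x) -> mu f <= mu g.
Proof.
by move=> fg; rewrite (@dot_max f g g) ?le_max ?lexx// => x; rewrite max_r.
Qed.

Lemma dot0 f : (forall x, f x = 0) -> mu f = 0.
Proof.
by move=> f0; rewrite (@dotZ 0 f f) ?mul0r ?lexx ?ler01// => x; rewrite mul0r.
Qed.

Lemma dot_bigmax (I : Type) (s : seq I) (F : I -> C01 R X) g :
  (forall x, g x = \big[Num.max/0]_(i <- s) F i x) ->
  mu g = \big[Num.max/0]_(i <- s) mu (F i).
Proof.
have h01 : 0 <= (0 : R) <= 1 by rewrite lexx ler01.
elim: s g => [|i s IH] g gF.
  by rewrite big_nil; apply: dot0 => x; rewrite gF big_nil.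
pose h := \big[@C01_max R X/C01_cst X h01]_(i <- s) F i.
have hE x : h x = \big[Num.max/0]_(i <- s) F i x.
  by apply: (big_morph (fun f : C01 R X => f x)).
rewrite big_cons -(IH h)//; apply: dot_max => x.
by rewrite gF big_cons hE.
Qed.

(** Each [psi i] is at most [1] and at every point one of them equals [1], so [f] is the maximum of
    the products [psi i * f]. *)
Lemma dot_cover (I : eqType) (s : seq I) (psi : I -> C01 R X) f :
  (forall x, exists2 i, i \in s & psi i x = 1) ->
  mu f = \big[Num.max/0]_(i <- s) mu (C01_mul (psi i) f).
Proof.
move=> cov; apply: dot_bigmax => x; apply/eqP; rewrite eq_le; apply/andP; split.
  have [i si pi1] := cov x; apply: (bigmax_sup_seq _ _ _ _ _ si) => //.
  by rewrite C01_mulE pi1 mul1r.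
apply: bigmaxr_le => [|i]; first exact: C01_ge0.
by rewrite -[leRHS]mul1r C01_mulE ler_wpM2r ?C01_ge0 ?C01_le1.
Qed.

End FixedMeasure.

(* Identically [0], hence not a dot-measure, when [mu psi = 0]. *)
Definition restrict mu psi : {ptws C01 R X -> R} :=
  fun f => mu (C01_mul psi f) / mu psi.

Section Restrict.
Context (mu : {ptws C01 R X -> R}) (Amu : dot_measures R X mu).
Context (psi : C01 R X) (psi_gt0 : 0 < mu psi).

Lemma restrict_dot : dot_measures R X (restrict mu psi).
Proof.
have psiV0 : 0 <= (mu psi)^-1 by rewrite invr_ge0 ltW.
split=> [f||l l01 f|f g]; rewrite /restrict.
- rewrite mulr_ge0 ?dot_ge0//= ler_pdivrMr// mul1r; apply: dot_le => // x.
  by rewrite -[leRHS]mulr1 C01_mulE ler_wpM2l ?C01_ge0 ?C01_le1.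
- rewrite (_ : C01_mul psi _ = psi) ?divff ?gt_eqF//.
  by apply: C01_ext => x /=; exact: mulr1.
- rewrite (dotZ Amu (f := C01_mul psi f) l01) ?mulrA// => x.
  exact: mulrCA.
- rewrite -maxr_pMl//; congr (_ * _); apply: dot_max => // x.
  by rewrite -maxr_pMr ?C01_ge0.
Qed.

Lemma restrictE f : mu psi * restrict mu psi f = mu (C01_mul psi f).
Proof. by rewrite mulrCA divff ?mulr1// gt_eqF. Qed.

(** The hypothesis gives [psi * f <= c * psi] everywhere, and [mu] is monotone and homogeneous. Only
    scalars in the unit interval can be pulled out of [mu], so [c > 1] is treated apart. *)
Lemma restrict_le (c : R) f : 0 <= c ->
  (forall x, psi x != 0 -> f x <= c) -> restrict mu psi f <= c.
Proof.
move=> c0 fc; have [c1|/ltW c1] := leP c 1; last first.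
  by rewrite (le_trans _ c1)// dot_le1//; exact: restrict_dot.
have c01 : 0 <= c <= 1 by rewrite c0.
rewrite ler_pdivrMr//.
rewrite -(dotZ Amu (g := C01_mul (C01_cst X c01) psi) c01)//.
apply: dot_le => // x; have [p0|p0] := eqVneq (psi x) 0.
  by rewrite !C01_mulE p0 mul0r mulr0.
by rewrite !C01_mulE mulrC ler_wpM2r ?C01_ge0// fc.
Qed.

Lemma restrict_ge (c : R) f : c <= 1 ->
  (forall x, psi x != 0 -> c <= f x) -> c <= restrict mu psi f.
Proof.
move=> c1 fc; have [c0|/ltW c0] := leP 0 c; last first.
  by rewrite (le_trans c0)// dot_ge0//; exact: restrict_dot.
have c01 : 0 <= c <= 1 by rewrite c0.
rewrite ler_pdivlMr//.
rewrite -(dotZ Amu (g := C01_mul (C01_cst X c01) psi) c01)//.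
apply: dot_le => // x; have [p0|p0] := eqVneq (psi x) 0.
  by rewrite !C01_mulE p0 mul0r mulr0.
by rewrite !C01_mulE mulrC ler_wpM2l ?C01_ge0// fc.
Qed.

(** Here [c - e] may be negative and [c + e] may exceed [1]; this is why each one-sided bound above
    constrains its constant on one side only. *)
Lemma restrict_dist (c e : R) f : 0 <= c <= 1 -> 0 <= e ->
  (forall x, psi x != 0 -> `|f x - c| <= e) -> `|restrict mu psi f - c| <= e.
Proof.
move=> /andP[c0 c1] e0 fc; rewrite ler_distl; apply/andP; split.
- apply: restrict_ge => [|x /fc]; first by lra.
  by rewrite ler_distl => /andP[].
- apply: restrict_le => [|x /fc]; first by lra.
  by rewrite ler_distl => /andP[].
Qed.

End Restrict.
End DotMeasureTheory.

(** * Finitely supported measures *)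

Section Omega.
Context (R : realType) (X : topologicalType).
Implicit Types (mu nu : {ptws C01 R X -> R}) (f g psi : C01 R X).
Local Notation omega := (dot_measures_omega R X).

Lemma omega_seq (I : Type) (s : seq I) (x : I -> X) (l : I -> R) :
  unit_range l -> \big[Num.max/0]_(i <- s) l i = 1 ->
  omega (fun f => \big[Num.max/0]_(i <- s) (l i * f (x i))).
Proof.
move=> l01 l1; exists (size s).
exists (fun i => x (tnth (in_tuple s) i)), (fun i => l (tnth (in_tuple s) i)).
split=> [i||]; first exact: l01.
  by rewrite -l1 [RHS]big_tnth.
by apply/funext => f; rewrite big_tnth.
Qed.

Lemma omega_dirac (x : X) : omega (@dirac_functional R X x).
Proof.
exists 1%N, (fun=> x), (fun=> 1); split=> [i||].
- by rewrite ler01 lexx.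
- by rewrite big_ord_recl big_ord0 max_l.
- by apply/funext => f; rewrite big_ord_recl big_ord0 mul1r max_l ?C01_ge0.
Qed.

Lemma omega_join (t p : R) (x : X) nu : J R (t, p) -> omega nu ->
  omega (fun f => Num.max (t * f x) (p * nu f)).
Proof.
move=> [/= /andP[t0 t1] /andP[p0 p1] tp1] [n [y [l [l01 l1 ->]]]].
(* Index [0] carries the new point [x] with weight [t]; the other indices carry the old points, with
   weights multiplied by [p]. *)
exists n.+1, (fun i => if unlift ord0 i is Some j then y j else x).
exists (fun i => if unlift ord0 i is Some j then p * l j else t).
split=> [i||].
- case: unliftP => [j _|_]; last by rewrite t0.
  by have /andP[? ?] := l01 j; rewrite mulr_ge0//= mulr_ile1.
- rewrite big_ord_recl unlift_none; under eq_bigr do rewrite liftK.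
  by rewrite bigmaxrM// l1 mulr1.
- apply/funext => f; rewrite big_ord_recl unlift_none.
  under [in RHS]eq_bigr do rewrite liftK -mulrA.
  by rewrite bigmaxrM.
Qed.

Lemma bigmaxr_eq1 (I : eqType) (s : seq I) (l : I -> R) :
  \big[Num.max/0]_(i <- s) l i = 1 -> exists2 i, i \in s & l i = 1.
Proof.
elim: s => [|i s IH]; first by rewrite big_nil => /eqP; rewrite eq_sym oner_eq0.
rewrite big_cons; case: leP => _ => [/IH[j sj lj]|li].
  by exists j; rewrite // inE sj orbT.
by exists i; rewrite // inE eqxx.
Qed.

(* Since some weight of [\/_i l_i . delta_(x_i)] is [1], the functional is not
   changed by joining it with that Dirac functional, so that it is reached from a
   Dirac functional by successive joins, without renormalizing the weights. *)
Lemma omega_ind (P : {ptws C01 R X -> R} -> Prop) :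
  (forall x, P (@dirac_functional R X x)) ->
  (forall (l : R) x nu, 0 <= l <= 1 -> omega nu -> P nu ->
     P (fun f => Num.max (l * f x) (nu f))) ->
  forall nu, omega nu -> P nu.
Proof.
move=> Pdirac Pjoin _ [n [x [l [l01 l1 ->]]]].
have [i0 _ li0] := bigmaxr_eq1 l1.
(* [Pjoin] needs its measure in [omega], so both properties are carried through the induction on the
   list of indices. *)
have [_] : (omega `&` P) (fun f => Num.max
    (\big[Num.max/0]_(i <- index_enum 'I_n) (l i * f (x i))) (f (x i0))).
  elim: (index_enum _) => [|i s [IHomega IHP]].
    rewrite (_ : (fun _ => _) = @dirac_functional R X (x i0)).
      by split=> //; exact: omega_dirac.
    by apply/funext => f; rewrite big_nil max_r ?C01_ge0.
  pose nu f := Num.max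
    (\big[Num.max/0]_(i <- s) (l i * f (x i))) (f (x i0)).
  rewrite (_ : (fun _ => _) = fun f => Num.max (l i * f (x i)) (nu f)).
    split; last exact: Pjoin.
    have lJ : J R (l i, 1).
      by split=> //=; [rewrite ler01 lexx|rewrite max_r//; case/andP: (l01 i)].
    have := omega_join (x i) lJ IHomega; congr omega; apply/funext => f.
    by rewrite mul1r.
  by apply/funext => f; rewrite big_cons -maxA.
congr P; apply/funext => f; apply/max_idPl.
apply: (bigmax_sup_seq _ _ _ _ _ (mem_index_enum i0)) => //.
by rewrite li0 mul1r.
Qed.

Lemma omega_dot : omega `<=` dot_measures R X.
Proof.
apply: (@omega_ind (dot_measures R X)) => [x|l x nu /andP[l0 l1] _ Anu].
  by split=> // f; rewrite /dirac_functional C01_ge0 C01_le1.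
split=> [f||k k01 f|f g].
- rewrite le_max dot_ge0// orbT ge_max dot_le1// andbT.
  by rewrite mulr_ile1 ?C01_ge0 ?C01_le1.
- by rewrite dot1// mulr1 max_r.
- rewrite (dotZ Anu (f := f) k01)// mulrCA maxr_pMr//.
  by case/andP: k01.
- by rewrite (@dot_max _ _ _ Anu f g)// maxACA -maxr_pMr.
Qed.

End Omega.

(** * Bump functions and barycenters *)

Lemma nbhs_forall_seq (S : topologicalType) (I : eqType) (s : seq I) (x : S)
    (P : I -> set S) : (forall i, nbhs x (P i)) ->
  nbhs x [set y | forall i, i \in s -> P i y].
Proof.
move=> Px; elim: s => [|i s IH]; first exact: filterS filterT.
apply: filterS (filterI (Px i) IH) => y [Py Psy] j.
by rewrite inE => /predU1P[->|/Psy].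
Qed.

(** The piece [mu (C01_mul psi f)] is [mu psi] times the value of the restriction, and
    [mu psi <= 1]. If [mu psi = 0], both terms vanish, so the restriction matters only for positive
    mass. *)
Lemma dot_mul_dist (R : realType) (S : topologicalType)
    (mu : {ptws C01 R S -> R}) (psi f : C01 R S) (c e : R) :
  dot_measures R S mu -> 0 <= e ->
  (0 < mu psi -> `|restrict mu psi f - c| <= e) ->
  `|mu psi * c - mu (C01_mul psi f)| <= e.
Proof.
move=> Amu e0 fc; have := dot_ge0 Amu psi; rewrite le_eqVlt => /predU1P[mu0|mu0].
  have -> : mu (C01_mul psi f) = 0.
    apply/eqP; rewrite eq_le dot_ge0// andbT [leRHS]mu0; apply: dot_le => // x.
    by rewrite -[leRHS]mulr1 C01_mulE ler_wpM2l ?C01_ge0 ?C01_le1.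
  by rewrite -mu0 mul0r subrr normr0.
rewrite -restrictE// -mulrBr normrM (gtr0_norm mu0) distrC.
by rewrite -[leRHS]mul1r ler_pM ?fc ?dot_le1 ?(ltW mu0).
Qed.

Lemma omega_discretize (R : realType) (S : topologicalType) (I : eqType)
    (mu : {ptws C01 R S -> R}) (r : seq I) (psi : I -> C01 R S) (x : I -> S) :
  dot_measures R S mu -> (forall v, exists2 i, i \in r & psi i v = 1) ->
  dot_measures_omega R S
    (fun f => \big[Num.max/0]_(i <- r) (mu (psi i) * f (x i))).
Proof.
move=> Amu cov; apply: omega_seq => [i|]; first by rewrite dot_ge0 ?dot_le1.
(* Cutting the constant [1] shows that the weights [mu (psi i)] have maximum [1]. *)
have := dot_cover Amu (C01_cst _ (unit_01 R)) cov.
rewrite (dot1 Amu)// => ->; apply: eq_bigr => i _; congr mu.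
by apply: C01_ext => v; rewrite C01_mulE mulr1.
Qed.

Lemma C01_tent (R : realType) (S : topologicalType) (f : C01 R S) (c e : R) :
  0 < e -> exists psi : C01 R S,
    (forall v, `|f v - c| < e / 2 -> psi v = 1) /\
    (forall v, psi v != 0 -> `|f v - c| <= e).
Proof.
move=> e0; have e20 : 0 < e / 2 by lra.
(* [w] is at least [1] where the distance is at most [e / 2], and at most [0] where it is at least
   [e]; clamping it to the unit interval gives the tent. *)
pose w (v : S) : R := 2 - `|f v - c| / (e / 2).
have wc : continuous w.
  move=> v; apply: cvgB; first exact: cvg_cst.
  apply: cvgM; last exact: cvg_cst.
  apply: cvg_norm; apply: cvgB; last exact: cvg_cst.
  exact: C01_continuous.
have cstc (a : R) : continuous (fun _ : S => a) by move=> v; exact: cvg_cst.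
have h : continuous (fun v => Num.min 1 (Num.max 0 (w v))) /\
    unit_range (fun v => Num.min 1 (Num.max 0 (w v))).
  split.
    exact: (min_fun_continuous (cstc 1) (max_fun_continuous (cstc 0) wc)).
  by move=> v; rewrite le_min ler01 le_max lexx ge_min lexx.
exists (exist (fun g : S -> R => continuous g /\ unit_range g) _ h); split=> v.
  move=> vu; have w1 : 1 <= w v.
    by rewrite /w lerBrDr addrC -lerBrDr ler_pdivrMr//; lra.
  by apply/min_idPl; rewrite le_max w1 orbT.
rewrite /C01_fun /=; apply: contraNT; rewrite -ltNge => ev.
rewrite max_l ?min_r ?ler01//.
by rewrite /w lerBlDr add0r ler_pdivlMr//; lra.
Qed.

Section Convex.
Context (R : realType) (T : Type) (X : set {ptws T -> R}).
Context (X01 : X `<=` cube R T).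
Implicit Types (mu nu : {ptws C01 R X -> R}) (f g psi : C01 R X).
Local Notation omega := (dot_measures_omega R X).
Local Notation beta := (barycenter X01).

Lemma C01_near f (u : X) (e : R) : 0 < e -> nbhs u [set v | `|f v - f u| < e].
Proof.
move=> e0; have /cvgrPdist_lt/(_ e e0) := @C01_continuous R X f u.
by apply: filterS => v; rewrite distrC.
Qed.

Lemma C01_prE t (u : X) : C01_pr X01 t u = (set_val u : {ptws T -> R}) t.
Proof. by []. Qed.

(* A neighborhood of [u] need not be max-dot convex, yet it contains a box around
   [u], and a measure carried by a box has its barycenter in that box. *)
Lemma exists_bump (u : X) (K : set X) : nbhs u K -> exists psi : C01 R X,
  [/\ nbhs u [set v | psi v = 1],
      forall v, psi v != 0 -> K v
    & forall mu, dot_measures R X mu -> 0 < mu psi ->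
        forall b : X, set_val b = beta (restrict mu psi) -> K b].
Proof.
move=> /nbhs_set_val[V uV VK].
have [s [e e0 sV]] := ptws_nbhs_basis uV.
have e20 : 0 < e / 2 by lra.
have e2e : e / 2 < e by lra.
have [psi [psi1 psis]] : exists psi : C01 R X, nbhs u [set v | psi v = 1] /\
    forall v, psi v != 0 -> forall t, t \in s ->
      `|C01_pr X01 t v - C01_pr X01 t u| <= e / 2.
  (* The bump is a product of tents, one for each coordinate of the box. *)
  elim: {sV} s => [|t s [psi [psi1 psis]]].
    exists (C01_cst _ (unit_01 R)); split=> //.
    exact: filterS filterT.
  have [phi [phi1 phis]] := C01_tent (C01_pr X01 t) (C01_pr X01 t u) e20.
  have e40 : 0 < e / 2 / 2 by lra.
  have {}phi1 : nbhs u [set v | phi v = 1].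
    exact: filterS (C01_near (C01_pr X01 t) u e40).
  exists (C01_mul phi psi); split.
    apply: filterS (filterI phi1 psi1) => v [/= phv psv].
    by rewrite phv psv mulr1.
  move=> v; rewrite C01_mulE mulf_eq0 negb_or => /andP[/phis phv /psis psv] i.
  by rewrite inE => /predU1P[->|/psv].
exists psi; split=> // [v /psis psv|mu Amu mu0 b bE]; apply: VK; apply: sV.
  by move=> t /psv /le_lt_trans; exact.
move=> t ts; rewrite bE /barycenter -C01_prE.
apply: le_lt_trans e2e; apply: restrict_dist => //; first by rewrite C01_ge0 C01_le1.
  exact: ltW.
by move=> v /psis; exact.
Qed.

Lemma barycenter_continuous :
  continuous (beta : {ptws C01 R X -> R} -> {ptws T -> R}).
Proof.
move=> mu; have h t : (fun h => h t) @ (beta @ nbhs mu) --> beta mu t.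
  exact: (@ptws_eval_continuous R _ (C01_pr X01 t) mu).
exact: (@ptws_cvgP R T (beta @ nbhs mu) (beta mu) _ h).
Qed.

Hypothesis (Xconvex : maxdot_convex X).

(** The barycenter of a join is the very combination under which [maxdot_convex] closes [X]. *)
Lemma barycenter_omega nu : omega nu -> X (beta nu).
Proof.
move: nu; apply: (@omega_ind _ _ (X \o beta)) => [x|l x nu l01 _ Xnu].
  exact: (set_valP x).
exact: (Xconvex (set_valP x) Xnu l01).
Qed.

Hypothesis (Xcompact : compact X).

Lemma ptws_compact_closed : closed X.
Proof.
apply: compact_closed => //.
by apply: (@hausdorff_product {classic T} (fun=> R)) => _; exact: Rhausdorff.
Qed.

(** As [X] is closed, it is enough to approximate [beta mu] by barycenters of finitely supported
    measures, which lie in [X]. *)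
Lemma barycenter_dot mu : dot_measures R X mu -> X (beta mu).
Proof.
move=> Amu; apply: ptws_compact_closed => B /ptws_nbhs_basis[s [e e0 sB]].
have e20 : 0 < e / 2 by lra.
have e2e : e / 2 < e by lra.
pose K (u : X) : set X := [set v | forall t, t \in s ->
  `|C01_pr X01 t v - C01_pr X01 t u| < e / 2].
have Kn u : nbhs u (K u) by apply: nbhs_forall_seq => t; exact: C01_near.
have [psi psiP] := choice (fun u => exists_bump (Kn u)).
have psi1 u : nbhs u [set v | psi u v = 1] by case: (psiP u).
have [r cov] := compact_set_type_cover Xcompact psi1.
(* The Dirac masses sit at the centers [u], since it is not yet known that the pieces of [mu] have
   their barycenters in [X]. *)
pose nu : {ptws C01 R X -> R} :=
  fun f => \big[Num.max/0]_(u <- r) (mu (psi u) * f u).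
have onu : omega nu by exact: omega_discretize.
exists (beta nu); split; first exact: barycenter_omega.
apply: sB => t ts; rewrite /barycenter (dot_cover Amu (C01_pr X01 t) cov).
apply: le_lt_trans e2e; apply: dist_bigmaxr => [|u]; first exact: ltW.
apply: dot_mul_dist => //; first exact: ltW.
move=> mu0; apply: restrict_dist => // [||v psiv].
- by rewrite C01_ge0 C01_le1.
- exact: ltW.
- by have [_ /(_ v psiv) Kv _] := psiP u; exact: ltW (Kv t ts).
Qed.

Lemma omega_dense_fiber mu (U : set {ptws C01 R X -> R}) :
  dot_measures R X mu -> nbhs mu U ->
  exists nu, [/\ omega nu, U nu & beta nu = beta mu].
Proof.
move=> Amu /ptws_nbhs_basis[s [e e0 sU]].
have e40 : 0 < e / 4 by lra.
have e2e : e / 4 + e / 4 < e by lra.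
pose K (u : X) : set X := [set v | forall f, f \in s -> `|f v - f u| < e / 4].
have Kn u : nbhs u (K u).
  apply: (@nbhs_forall_seq _ _ s u
    (fun f : C01 R X => [set v | `|f v - f u| < e / 4])) => f.
  exact: C01_near.
have [psi psiP] := choice (fun u => exists_bump (Kn u)).
have psi1 u : nbhs u [set v | psi u v = 1] by case: (psiP u).
have [r cov] := compact_set_type_cover Xcompact psi1.
(* By [barycenter_dot], each piece of positive mass has its barycenter in [X]; a piece of mass [0]
   gets an arbitrary point, as its weight is [0]. *)
have /choice[x xE] : forall u, exists b : X,
    0 < mu (psi u) -> set_val b = beta (restrict mu (psi u)).
  move=> u; have [mu0|_] := ltP 0 (mu (psi u)); last by exists u.
  by exists (SigSub (mem_set (barycenter_dot (restrict_dot Amu mu0)))).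
exists (fun f => \big[Num.max/0]_(u <- r) (mu (psi u) * f (x u))); split.
- exact: omega_discretize.
- apply: sU => f fs; rewrite (dot_cover Amu f cov); apply: le_lt_trans e2e.
  have e20 : 0 <= e / 4 + e / 4 by rewrite addr_ge0 ?ltW.
  apply: dist_bigmaxr => // u; apply: dot_mul_dist => // mu0.
  have [_ psiK betaK] := psiP u.
  (* Both the value of the restriction at [f] and [f (x u)] are within [e / 4] of [f u]. *)
  rewrite -(subrKA ((f : C01 R X) u)) (le_trans (ler_normD _ _))// lerD//.
    apply: restrict_dist => // [||v /psiK/(_ f fs)/ltW//].
      by rewrite C01_ge0 C01_le1.
    exact: ltW.
  by rewrite distrC ltW//; apply: (betaK mu) => //; exact: xE.
- apply/funext => t; rewrite /barycenter (dot_cover Amu _ cov).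
  (* The error bound is now [0]: the coordinates of [x u] are exactly the values of the restriction
     at the projections. *)
  apply: eq_bigr => u _; apply/eqP; rewrite -subr_eq0 -normr_le0.
  apply: dot_mul_dist => // mu0.
  by rewrite C01_prE (xE u mu0) subrr normr0.
Qed.

End Convex.

(** * Openness *)

Lemma cvg_max (d : Order.disp_t) (V : orderTopologicalType d) (S : Type)
    (F : set_system S) (FF : Filter F) (f g : S -> V) (a b : V) :
  f @ F --> a -> g @ F --> b ->
  (fun x => Order.max (f x) (g x)) @ F --> Order.max a b.
Proof.
move=> fa gb; apply: (continuous2_cvg _ _ fa gb).
exact: (@max_continuous _ V (a, b)).
Qed.

Lemma cvg_pair2 (S : Type) (F : set_system S) {FF : Filter F}
    (S1 S2 S3 S4 : topologicalType) (f : S -> S1) (g : S -> S2) (h : S -> S3)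
    (k : S -> S4) (a : S1) (b : S2) (c : S3) (d : S4) :
  f @ F --> a -> g @ F --> b -> h @ F --> c -> k @ F --> d ->
  (fun x => (f x, g x, (h x, k x))) @ F --> (a, b, (c, d)).
Proof.
by move=> fa gb hc kd; exact: (cvg_pair (cvg_pair fa gb) (cvg_pair hc kd)).
Qed.

Lemma continuous_pair_cst (S S1 S2 S3 : topologicalType) (f : S -> S1)
    (g : S -> S2) (c : S3) : continuous f -> continuous g ->
  continuous (fun x => (f x, g x, c)).
Proof.
move=> fc gc x.
exact: (cvg_pair (cvg_pair (fc x) (gc x)) (@cvg_cst S3 c _ (nbhs x) _)).
Qed.

Section Continuity.
Context (R : realType).

Lemma C01_separate (S : topologicalType) (h : C01 R S) (x y : S) : h x != h y ->
  exists psi1 psi2 : C01 R S,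
    [/\ forall v, Num.max (psi1 v) (psi2 v) = 1, psi1 y = 0 & psi2 x = 0].
Proof.
(* By the triangle inequality, [h v] is at distance at least [d] from one of [h x] and [h y], so
   [w x v] or [w y v] is [1]. *)
move=> hxy; pose d := `|h x - h y| / 2.
have d0 : 0 < d by rewrite divr_gt0// normr_gt0 subr_eq0.
pose w z (v : S) : R := Num.min 1 (`|h v - h z| / d).
have w01 z : continuous (w z) /\ unit_range (w z).
  split.
    apply: min_fun_continuous => v; first exact: cvg_cst.
    apply: cvgM; last exact: cvg_cst.
    apply: cvg_norm; apply: cvgB; last exact: cvg_cst.
    exact: C01_continuous.
  by move=> v; rewrite ge_min lexx le_min ler01 divr_ge0 ?(ltW d0).
have wz z : w z z = 0 by rewrite /w subrr normr0 mul0r min_r.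
pose C := fun g : S -> R => continuous g /\ unit_range g.
exists (exist C _ (w01 y)), (exist C _ (w01 x)).
split=> [v||]; [|exact: wz|exact: wz].
apply/eqP; rewrite eq_le; apply/andP; split.
  by rewrite ge_max !C01_le1.
have : `|h x - h y| <= `|h v - h x| + `|h v - h y|.
  by rewrite (distrC (h v) (h x)) ler_distD.
rewrite /C01_fun /= /w !le_max !le_min lexx /= !ler_pdivlMr// !mul1r.
rewrite (splitr `|h x - h y|) -/d => dxy.
by case: (leP d `|h v - h y|) => //=; case: (leP d `|h v - h x|) => //; lra.
Qed.

Lemma join_continuous (S : topologicalType)
    (z0 : S * {ptws C01 R S -> R} * (R * R)) :
  (fun z : S * {ptws C01 R S -> R} * (R * R) =>
     (fun f : C01 R S => Num.max (z.2.1 * f z.1.1) (z.2.2 * z.1.2 f)))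
     @ nbhs z0 --> ((fun f : C01 R S =>
     Num.max (z0.2.1 * f z0.1.1) (z0.2.2 * z0.1.2 f)) : {ptws C01 R S -> R}).
Proof.
apply: ptws_cvgP => f; move: z0 => [[x nu] [t p]].
apply: cvg_max; apply: cvgM.
- by apply: (@continuous_comp _ _ _ snd fst); [exact: cvg_snd|exact: cvg_fst].
- apply: (@continuous_comp _ _ _ (fst \o fst) f); last exact: C01_continuous.
  by apply: (@continuous_comp _ _ _ fst fst); [exact: cvg_fst|exact: cvg_fst].
- by apply: (@continuous_comp _ _ _ snd snd); [exact: cvg_snd|exact: cvg_snd].
- apply: (@continuous_comp _ _ _ (snd \o fst)
    (fun nu : {ptws C01 R S -> R} => nu f)); last exact: ptws_eval_continuous.
  by apply: (@continuous_comp _ _ _ fst snd); [exact: cvg_fst|exact: cvg_snd].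
Qed.

Lemma restrict_cvg (S : topologicalType) (mu : {ptws C01 R S -> R})
    (psi : C01 R S) : mu psi != 0 ->
  (fun nu : {ptws C01 R S -> R} => restrict nu psi) @ nbhs mu --> restrict mu psi.
Proof.
move=> mu0.
have h (f : C01 R S) :
    (fun nu : {ptws C01 R S -> R} => nu (C01_mul psi f) / nu psi) @ nbhs mu -->
    mu (C01_mul psi f) / mu psi.
  apply: cvgM; first exact: (@ptws_eval_continuous R _ (C01_mul psi f) mu).
  by apply: cvgV => //; exact: (@ptws_eval_continuous R _ psi mu).
exact: (@ptws_cvgP R _ ((fun nu : {ptws C01 R S -> R} => restrict nu psi) @ nbhs mu)
  (restrict mu psi) _ h).
Qed.

Lemma dirac_continuous (S : topologicalType) : continuous (@dirac_functional R S).
Proof.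
move=> x; have h (f : C01 R S) :
    (fun h => h f) @ (@dirac_functional R S @ x) --> dirac_functional x f.
  exact: (@C01_continuous R S f x).
exact: (@ptws_cvgP R _ (@dirac_functional R S @ x) (dirac_functional x) _ h).
Qed.

End Continuity.

Section Main.
Context (R : realType) (T : Type) (X : set {ptws T -> R}).
Context (X01 : X `<=` cube R T) (Xconvex : maxdot_convex X) (Xcompact : compact X).
Local Notation omega := (dot_measures_omega R X).
Local Notation A := (dot_measures R X).
Local Notation beta := (barycenter X01).

Lemma s_map_in z : (X `*` X `*` J R) z -> X (s_map R T z).
Proof.
move: z => [[x y] [t p]] [/= [Xx Xy]] [/= t01 p01 tp].
(* The larger of [t] and [p] is [1], so this is the operation of [maxdot_convex], up to exchanging
   [x] and [y]. *)
rewrite /s_map /=; case: (leP t p) tp => _ ->.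
  have := Xconvex Xx Xy t01; congr X; apply/funext => i; by rewrite mul1r.
have := Xconvex Xy Xx p01; congr X; apply/funext => i.
by rewrite mul1r maxC.
Qed.

Lemma barycenter_omega_image (U : set {ptws C01 R X -> R}) : open U ->
  beta @` (omega `&` U) = beta @` (A `&` U).
Proof.
move=> oU; rewrite eqEsubset; split=> [_ [nu [/omega_dot Anu Unu] <-]|].
  by exists nu.
move=> _ [mu [Amu Umu] <-].
have [nu [onu Unu bnu]] := omega_dense_fiber X01 Xconvex Xcompact Amu
  (open_nbhs_nbhs (conj oU Umu)).
by exists nu.
Qed.

Lemma open_barycenter_omega :
  open_map_on omega X beta <-> open_map_on A X beta.
Proof.
by split=> bo U oU; have [V oV bV] := bo U oU; exists V => //;
  rewrite -bV barycenter_omega_image.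
Qed.

Lemma open_s_map_omega :
  open_map_on (X `*` X `*` J R) X (s_map R T) -> open_map_on omega X beta.
Proof.
move=> /(open_map_onP s_map_in) so.
apply/open_map_onP => [nu|nu U onu]; first exact: barycenter_omega.
move: nu onu U; apply: (@omega_ind _ _ (fun nu => forall U, nbhs nu U ->
  nbhs (beta nu) [set z | X z -> (beta @` (omega `&` U)) z])).
  move=> x U /(@dirac_continuous R X x)/nbhs_set_val[V xV VU].
  apply: filterS xV => z Vz Xz.
  exists (@dirac_functional R X (SigSub (mem_set Xz))) => //.
  by split; [exact: omega_dirac|exact: VU].
move=> l x nu l01 onu IH U.
have Jl1 : J R (l, 1).
  by split=> //=; [rewrite ler01 lexx|rewrite max_r//; case/andP: l01].
have -> : (fun f : C01 R X => Num.max (l * f x) (nu f)) =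
    (fun f => Num.max (l * f x) (1 * nu f)).
  by apply/funext => f; rewrite mul1r.
move=> /(@join_continuous R X ((x, nu), (l, 1))).
case=> -[Q QJ] [/= [[Qx Qnu] [/= xQ nuQ] QxQnu] lQ] QU.
have /nbhs_set_val[V xV VQ] := xQ.
pose z0 : {ptws T -> R} * {ptws T -> R} * (R * R) :=
  ((set_val x, beta nu), (l, 1)).
have XXJ : (X `*` X `*` J R) z0.
  by split=> //; split=> //=; [exact: (set_valP x)|exact: barycenter_omega].
pose W := [set z | X z -> (beta @` (omega `&` Qnu)) z].
have nW : nbhs z0 (V `*` W `*` QJ).
  exists (V `*` W, QJ) => //; split=> //; exists (V, W) => //.
  by split=> //; exact: IH.
(* Points of [X] near the barycenter are [s_map] of some [a] near [x] and [b] near [beta nu]. The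
   induction hypothesis lifts [b] to [nu'], and joining [nu'] with the Dirac measure at [a] lifts
   the point. *)
have := so _ _ XXJ nW.
apply: filterS => z sz /sz[[[a b] [t p]] [[[Xa Xb] Jtp] [[Va Wb] QJtp]] <-].
have [nu' [onu' Qnu'] bE] := Wb Xb.
rewrite /= in bE; pose v : X := SigSub (mem_set Xa).
exists (fun f : C01 R X => Num.max (t * f v) (p * nu' f)).
  split; first exact: omega_join.
  by apply: (QU ((v, nu'), (t, p))); split=> //; apply: QxQnu; split=> //; exact: VQ.
by apply/funext => i; rewrite /s_map /= -bE.
Qed.

(** The section passes through [z], so the preimage of [U] under [sigma] is a neighborhood whose
    points in [X] all lie in the image of [U]. *)
Lemma open_s_map_section (z : {ptws T -> R} * {ptws T -> R} * (R * R)) U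
    (sigma : {ptws T -> R} -> {ptws T -> R} * {ptws T -> R} * (R * R)) :
  nbhs z U -> sigma (s_map R T z) = z -> {for s_map R T z, continuous sigma} ->
  (forall b, X b -> (X `*` X `*` J R) (sigma b) /\ s_map R T (sigma b) = b) ->
  nbhs (s_map R T z)
    [set b | X b -> (s_map R T @` ((X `*` X `*` J R) `&` U)) b].
Proof.
move=> zU sz sc sE.
have : nbhs (s_map R T z) (sigma @^-1` U) by apply: sc; rewrite sz.
apply: filterS => b Ub Xb; have [XXJ sb] := sE _ Xb.
by exists (sigma b).
Qed.

Lemma open_barycenter_s_map :
  open_map_on A X beta -> open_map_on (X `*` X `*` J R) X (s_map R T).
Proof.
move=> /(open_map_onP (barycenter_dot X01 Xconvex Xcompact)) bo.
apply/(open_map_onP s_map_in) => -[[x y] [t p]] U XXJ xyU.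
have [[/= Xx Xy] [/= /andP[t0 t1] /andP[p0 p1] tp]] := XXJ.
have J10 : J R (1, 0) by split=> //=; rewrite ?lexx ?ler01// max_l.
have J01 : J R (0, 1) by split=> //=; rewrite ?lexx ?ler01// max_r.
have X0 (b : {ptws T -> R}) : X b -> forall i, 0 <= b i.
  by move=> /X01 b01 i; case/andP: (b01 i).
(* For [t = 0] the section keeps [x] and moves the second point. The coordinates of [b] are
   nonnegative, so the term of weight [0] drops out. *)
have [tE|tN] := eqVneq t 0.
  have pE : p = 1 by move: tp; rewrite tE max_r.
  subst t p.
  have sE (b : {ptws T -> R}) : X b -> s_map R T (x, b, (0, 1)) = b.
    move=> Xb; apply/funext => i.
    by rewrite /s_map /= mul0r mul1r max_r ?X0.
  apply: (@open_s_map_section _ _ (fun b => (x, b, (0, 1)))) => //.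
  - by rewrite sE.
  - apply: continuous_pair_cst.
      exact: cst_continuous.
    by move=> ?; exact: cvg_id.
  - by move=> b Xb; rewrite sE.
have [pE|pN] := eqVneq p 0.
  have tE : t = 1 by move: tp; rewrite pE max_l.
  subst t p.
  have sE (b : {ptws T -> R}) : X b -> s_map R T (b, y, (1, 0)) = b.
    move=> Xb; apply/funext => i.
    by rewrite /s_map /= mul0r mul1r max_l ?X0.
  apply: (@open_s_map_section _ _ (fun b => (b, y, (1, 0)))) => //.
  - by rewrite sE.
  - apply: continuous_pair_cst.
      by move=> ?; exact: cvg_id.
    exact: cst_continuous.
  - by move=> b Xb; rewrite sE.
(* For [x = y] the diagonal gives a section, because [t] and [p] have maximum [1]. *)
have [xy|/existsNP[i xyi]] := pselect (forall i, x i = y i).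
  have {}xy : x = y by exact/funext.
  subst y.
  have sE (b : {ptws T -> R}) : X b -> s_map R T (b, b, (t, p)) = b.
    move=> Xb; apply/funext => i.
    by rewrite /s_map /= -maxr_pMl ?X0// tp mul1r.
  apply: (@open_s_map_section _ _ (fun b => (b, b, (t, p)))) => //.
  - by rewrite sE.
  - by apply: continuous_pair_cst => ?; exact: cvg_id.
  - by move=> b Xb; rewrite sE//; split=> //; split=> //; exact: XXJ.2.
pose u : X := SigSub (mem_set Xx); pose v : X := SigSub (mem_set Xy).
have [|psi1 [psi2 [psi12 psi1v psi2u]]] := @C01_separate R X (C01_pr X01 i) u v.
  exact/eqP.
have psi1u : psi1 u = 1.
  by have := psi12 u; rewrite psi2u max_l ?C01_ge0.
have psi2v : psi2 v = 1.
  by have := psi12 v; rewrite psi1v max_r ?C01_ge0.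
pose mu : {ptws C01 R X -> R} := fun f => Num.max (t * f u) (p * f v).
have Amu : A mu := omega_dot (omega_join u XXJ.2 (omega_dirac R v)).
have mu1 : mu psi1 = t by rewrite /mu psi1u psi1v mulr1 mulr0 max_l.
have mu2 : mu psi2 = p by rewrite /mu psi2u psi2v mulr1 mulr0 max_r.
have r1 : beta (restrict mu psi1) = x.
  apply/funext => j; rewrite /barycenter /restrict mu1 /mu !C01_mulE psi1u psi1v.
  by rewrite mul1r mul0r mulr0 max_l ?mulr_ge0 ?C01_ge0// mulrAC divff// mul1r.
have r2 : beta (restrict mu psi2) = y.
  apply/funext => j; rewrite /barycenter /restrict mu2 /mu !C01_mulE psi2u psi2v.
  by rewrite mul1r mul0r mulr0 max_r ?mulr_ge0 ?C01_ge0// mulrAC divff// mul1r.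
(* For a dot-measure [nu] positive on [psi1] and [psi2], [s_map (phi nu) = beta nu]; moreover
   [phi mu] is the given point. *)
pose phi (nu : {ptws C01 R X -> R}) :=
  (beta (restrict nu psi1), beta (restrict nu psi2), (nu psi1, nu psi2)).
have phic : phi @ nbhs mu --> phi mu.
  have br (psi : C01 R X) : mu psi != 0 ->
      (fun nu => beta (restrict nu psi)) @ nbhs mu --> beta (restrict mu psi).
    move=> /restrict_cvg muc.
    exact: (cvg_comp _ _ muc (@barycenter_continuous _ _ _ X01 _)).
  have {}ev := @ptws_eval_continuous R (C01 R X).
  have b1 := br psi1; have b2 := br psi2; rewrite mu1 mu2 in b1 b2.
  exact: (cvg_pair2 (b1 tN) (b2 pN) (ev psi1 mu) (ev psi2 mu)).
have pos (psi : C01 R X) : mu psi != 0 ->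
    nbhs mu [set nu : {ptws C01 R X -> R} | 0 < nu psi].
  move=> mu0; have mu_gt0 : 0 < mu psi by rewrite lt_neqAle eq_sym mu0 dot_ge0.
  exact: (@ptws_eval_continuous R _ psi mu _ (lt_nbhsr mu_gt0)).
have nmu : nbhs mu (phi @^-1` U `&`
    ([set nu : {ptws C01 R X -> R} | 0 < nu psi1] `&`
     [set nu : {ptws C01 R X -> R} | 0 < nu psi2])).
  apply: filterI; last by apply: filterI; apply: pos; rewrite ?mu1 ?mu2.
  by apply: phic; rewrite /phi r1 r2 mu1 mu2.
(* [beta mu] unfolds to the value of [s_map] at the given point, so openness of [beta] at [mu]
   applies as it is. *)
apply: filterS (bo _ _ Amu nmu) => z bz /bz[nu [Anu [Unu [nu1 nu2]]] <-].
exists (phi nu).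
  split=> //; split=> /=.
    by split; apply: barycenter_dot => //; exact: restrict_dot.
  split=> /=; rewrite ?dot_ge0 ?dot_le1//.
  by rewrite -(dot_max Anu (h := C01_cst _ (unit_01 R))) ?dot1.
(* Multiplying by the masses undoes the division in [restrict], and the two pieces of the projection
   have the projection itself as maximum. *)
apply/funext => j; rewrite /s_map /= /barycenter !restrictE//.
apply/esym/(dot_max Anu) => w.
by rewrite !C01_mulE -maxr_pMl ?C01_ge0// psi12 mul1r.
Qed.

End Main.

Theorem theorem4 (R : realType) (T : Type) (X : set {ptws T -> R})
    (X01 : X `<=` cube R T) (Xconvex : maxdot_convex X) (Xcompact : compact X) :
  (open_map_on (dot_measures_omega R (set_type X)) X (barycenter X01) <->
   open_map_on (dot_measures R (set_type X)) X (barycenter X01)) /\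
  (open_map_on (dot_measures R (set_type X)) X (barycenter X01) <->
   open_map_on (X `*` X `*` J R) X (s_map R T)).
Proof.
have e12 := open_barycenter_omega X01 Xconvex Xcompact.
split; first exact: e12.
split; first exact: open_barycenter_s_map.
by move=> /(open_s_map_omega X01 Xconvex)/e12.
Qed.
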